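(* Let $R, T \in \mathrm{GL}_3(\mathbb{R})$ be the matrices $$R = \begin{pmatrix} 0 & 0 & -1\\ 1 & 0 & -1\\ 0 & 1 & -1 \end{pmatrix}, \qquad T = \begin{pmatrix} -1 & 0 & 0\\ 2 & 1 & 0\\ -4 & 0 & 1 \end{pmatrix},$$ which satisfy $R^4 = T^2 = I$. The subgroup of $\mathrm{GL}_3(\mathbb{R})$ generated by $R$ and $T$ is the (internal) free product of the cyclic subgroups $\langle R \rangle$ and $\langle T \rangle$; that is, $$\langle R, T\rangle = \langle R \rangle * \langle T \rangle = \mathbb{Z}/4\mathbb{Z} * \mathbb{Z}/2\mathbb{Z}.$$
   Context: Let $G_1,\dots,G_d$ be subgroups of a group $G$. A word in the elements of the $G_j$ is a finite sequence $(x_1,\dots,x_n)$ in which each $x_i$ lies in at least one $G_j$; it is an expression for the product $x_1\cdots x_n \in G$. A word is reduced if no $x_i$ is the identity and, for $i=1,\dots,n-1$, the elements $x_i$ and $x_{i+1}$ are not both contained in a single $G_j$; the empty word is reduced and expresses the identity. $G$ is the free product of $G_1,\dots,G_d$, written $G = G_1 * \cdots * G_d$, if every $g \in G$ has a unique reduced expression in the elements of the $G_j$. *)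

(* Defs.v *)
From HB Require Import structures.
From mathcomp Require Import all_boot all_order all_algebra all_fingroup.
From mathcomp Require Import boolp classical_sets reals ring.

Set Implicit Arguments.
Unset Strict Implicit.
Unset Printing Implicit Defensive.

Import GRing.Theory.

Section FreeProduct.
Local Open Scope classical_set_scope.
Local Open Scope group_scope.
Variable gT : groupType.

(* Subgroups of the possibly infinite group gT are Prop-valued sets. *)
Definition subgroup (H : set gT) : Prop := group_closed [in H].

Definition gen_subgroup (A : set gT) : set gT := smallest subgroup A.

Definition is_word (d : nat) (H : 'I_d -> set gT) (w : seq gT) : Prop :=
  forall x, x \in w -> exists j, H j x.

Definition reduced (d : nat) (H : 'I_d -> set gT) (w : seq gT) : Prop :=
  [/\ is_word H w,
      forall x, x \in w -> x <> 1
    & forall i, (i.+1 < size w)%N ->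
        ~ exists j, H j (nth 1 w i) /\ H j (nth 1 w i.+1)].

Definition free_product (G : set gT) (d : nat) (H : 'I_d -> set gT) : Prop :=
  [/\ subgroup G,
      forall j, subgroup (H j) /\ H j `<=` G
    & forall g, G g -> exists! w : seq gT,
        reduced H w /\ \prod_(x <- w) x = g].

(* Used with kT := 'Z_n, whose group law is addition modulo n. *)
Definition isomorphic_to (H : set gT) (kT : groupType) : Prop :=
  exists f : kT -> gT,
    [/\ {morph f : x y / x * y}, injective f & range f = H].

End FreeProduct.

Section GeneralLinear.
Local Open Scope ring_scope.

(* The library's {'GL_n[K]} requires K to be finite. *)
Record GL (n : nat) (K : comUnitRingType) :=
  MkGL { GLmx :> 'M[K]_n; GLmx_unit : GLmx \in unitmx }.

HB.instance Definition _ n K := [isSub for @GLmx n K].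
HB.instance Definition _ n K := [Choice of GL n K by <:].

Variables (n : nat) (K : comUnitRingType).
Implicit Types A B : GL n K.

Fact GL_one_unit : (1%:M : 'M[K]_n) \in unitmx.
Proof. exact: unitmx1. Qed.

Fact GL_mul_unit A B : A *m B \in unitmx.
Proof. by rewrite unitmx_mul !GLmx_unit. Qed.

Fact GL_inv_unit A : invmx A \in unitmx.
Proof. by rewrite unitmx_inv GLmx_unit. Qed.

Definition GL_one := MkGL GL_one_unit.
Definition GL_mul A B := MkGL (GL_mul_unit A B).
Definition GL_inv A := MkGL (GL_inv_unit A).

Fact GL_mulA : associative GL_mul.
Proof. by move=> A B C; apply: val_inj; apply: mulmxA. Qed.

Fact GL_mul1 : left_id GL_one GL_mul.
Proof. by move=> A; apply: val_inj; apply: mul1mx. Qed.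

Fact GL_mulr1 : right_id GL_one GL_mul.
Proof. by move=> A; apply: val_inj; apply: mulmx1. Qed.

Fact GL_mulV : left_inverse GL_one GL_inv GL_mul.
Proof. by move=> A; apply: val_inj; apply: mulVmx; apply: GLmx_unit. Qed.

Fact GL_mulrV : right_inverse GL_one GL_inv GL_mul.
Proof. by move=> A; apply: val_inj; apply: mulmxV; apply: GLmx_unit. Qed.

HB.instance Definition _ :=
  isGroup.Build (GL n K) GL_mulA GL_mul1 GL_mulr1 GL_mulV GL_mulrV.

End GeneralLinear.

Section Matrices.
Local Open Scope ring_scope.
Variable K : realType.

Definition mx3 (rows : seq (seq K)) : 'M[K]_3 :=
  \matrix_(i < 3, j < 3) nth 0 (nth [::] rows i) j.

Definition Rmx : 'M[K]_3 :=
  mx3 [:: [:: 0; 0; -1];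
          [:: 1; 0; -1];
          [:: 0; 1; -1] ].

Definition Tmx : 'M[K]_3 :=
  mx3 [:: [:: -1; 0; 0];
          [:: 2; 1; 0];
          [:: -4; 0; 1] ].

Fact Rmx_unit : Rmx \in unitmx.
Proof.
suff /mulmx1_unit[] : Rmx *m mx3 [:: [:: -1; 1; 0];
                                     [:: -1; 0; 1];
                                     [:: -1; 0; 0] ] = 1%:M by [].
apply/matrixP => -[[|[|[|i]]] Hi] // -[[|[|[|j]]] Hj] //;
  rewrite !mxE !big_ord_recl big_ord0 !mxE /=; ring.
Qed.

Fact Tmx_unit : Tmx \in unitmx.
Proof.
suff /mulmx1_unit[] : Tmx *m Tmx = 1%:M by [].
apply/matrixP => -[[|[|[|i]]] Hi] // -[[|[|[|j]]] Hj] //;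
  rewrite !mxE !big_ord_recl big_ord0 !mxE /=; ring.
Qed.

Definition Rgl : GL 3 K := MkGL Rmx_unit.
Definition Tgl : GL 3 K := MkGL Tmx_unit.

End Matrices.

(* Main.v *)
Require Import Defs.
From mathcomp Require Import all_boot all_order all_algebra all_fingroup.
From mathcomp Require Import boolp classical_sets reals.
From mathcomp Require Import ring lra zify.

Set Implicit Arguments.
Unset Strict Implicit.
Unset Printing Implicit Defensive.
Local Open Scope classical_set_scope.
Local Open Scope group_scope.

(** The group acts on K^3, and the theorem is an instance of the ping-pong
    lemma.  In suitable linear coordinates (alpha, beta, gamma), T sends
    (a, b, c) to (-c, b, -a), and the three products
    RT, -R^2 T and R^3 T all have nonnegative entries.  Therefore the cone C of
    vectors whose three coordinates are nonzero of one sign (the vectors of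
    both signs are included) is mapped into itself by R^k T for k = 1, 2, 3,
    while T C, where beta has the sign opposite to that of alpha and gamma, is
    disjoint from C.  Hence T exchanges C and T C, and every nontrivial power
    of R maps T C into C.  Geometrically, R and T preserve the form
    beta^2 - 2 alpha gamma of signature (2, 1) and act on the hyperbolic plane
    as a rotation of order 4 and a half-turn with parabolic product: these
    generate the triangle group (2, 4, oo).  After a
    rescaling of the coordinates, the nonnegative matrices above are symmetric
    squares of nonnegative 2 x 2 matrices.

    Ping-pong with these two pieces alone would compare reduced words of some
    shapes only after conjugation, because T has order 2.  A base point v
    outside both pieces avoids this: v is chosen in C so that R^k v is again in
    C for every k, and the piece of R becomes C minus v.  Removing v is
    harmless, since R^k T p = v would put T p = R^-k v in both C and T C when p
    is in C.  The first letter of a reduced word then determines the piece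
    that contains the image of v (reduced_act_head), which gives uniqueness of
    reduced expressions by induction (pingpong_unique).  Existence of reduced
    expressions (reduced_expression) needs only that the factors meet
    trivially, which ping-pong also provides.  The same images of v show that
    R and T have orders exactly 4 and 2. *)

(** * Generated and cyclic subgroups *)

Section Subgroups.
Variable gT : groupType.
Implicit Types (A H : set gT) (x y : gT).

Lemma subgroupP H :
  subgroup H <-> H 1 /\ (forall x y, H x -> H y -> H (x * y^-1)).
Proof.
have inH x : x \in [in H] <-> H x by rewrite -[X in _ <-> X]in_setE.
split=> -[H1 HB]; split; try exact/inH.
  by move=> x y /inH Hx /inH Hy; apply/inH/HB.
by move=> x y /inH Hx /inH Hy; apply/inH/HB.
Qed.

Lemma subgroup1 H : subgroup H -> H 1.
Proof. by case/subgroupP. Qed.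

Lemma subgroupV H x : subgroup H -> H x -> H x^-1.
Proof.
by case/subgroupP=> H1 HB Hx; rewrite -[x^-1]mul1g; apply: HB.
Qed.

Lemma subgroupM H x y : subgroup H -> H x -> H y -> H (x * y).
Proof.
move=> sH Hx Hy; rewrite -[y]invgK.
by case/subgroupP: (sH) => _; apply=> //; apply: subgroupV.
Qed.

Lemma subgroupX H x k : subgroup H -> H x -> H (x ^+ k).
Proof.
move=> sH Hx; elim: k => [|k IHk]; first by rewrite expg0; apply: subgroup1.
by rewrite expgS; apply: subgroupM.
Qed.

Lemma gen_subgroup_subgroup A : subgroup (gen_subgroup A).
Proof.
apply/subgroupP; split=> [H [sH _]|x y Ax Ay H [sH AH]]; first exact: subgroup1.
apply: subgroupM => //; first exact: Ax.
by apply: subgroupV => //; apply: Ay.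
Qed.

Lemma gen_subgroup_mono A B :
  A `<=` gen_subgroup B -> gen_subgroup A `<=` gen_subgroup B.
Proof.
by move=> AB; apply: smallest_sub => //; apply: gen_subgroup_subgroup.
Qed.

Lemma expg_modn x n k : x ^+ n = 1 -> x ^+ (k %% n) = x ^+ k.
Proof.
move=> xn.
by rewrite [in RHS](divn_eq k n) expgnDr mulnC expgnA xn expg1n mul1g.
Qed.

Lemma gen_subgroup1P x n : (0 < n)%N -> x ^+ n = 1 ->
  forall y, gen_subgroup [set x] y <-> exists2 k, (k < n)%N & y = x ^+ k.
Proof.
move=> n0 xn y; split; last first.
  move=> [k _ ->]; apply: (subgroupX (H := gen_subgroup _)).
    exact: gen_subgroup_subgroup.
  by move=> H [_ xH]; apply: xH.
apply: (smallest_sub (X := [set y | exists2 k, (k < n)%N & y = x ^+ k])).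
  apply/subgroupP; split; first by exists 0%N; rewrite ?expg0.
  move=> _ _ [i ilt ->] [j jlt ->].
  exists ((i + (n - j)) %% n)%N; first exact: ltn_pmod.
  rewrite expg_modn // expgnDr; congr (_ * _).
  by apply: (mulIg (x ^+ j)); rewrite mulVg -expgnDr subnK ?xn // ltnW.
move=> _ ->; exists (1 %% n)%N; first exact: ltn_pmod.
by rewrite expg_modn // expg1.
Qed.

Lemma gen_subgroup1_isomorphic_Zp x n : (1 < n)%N -> x ^+ n = 1 ->
    (forall k, (0 < k < n)%N -> x ^+ k <> 1) ->
  isomorphic_to (gen_subgroup [set x]) 'Z_n.
Proof.
move=> n1 xn ordx.
have ltZ (i : 'Z_n) : (i < n)%N by rewrite -[X in (_ < X)%N](Zp_cast n1).
exists (fun i : 'Z_n => x ^+ i); split.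
- by move=> i j /=; rewrite [X in (_ %% X)%N]Zp_cast // expg_modn // expgnDr.
- have inj (i j : 'Z_n) : (i <= j)%N -> x ^+ i = x ^+ j -> i = j.
    move=> leij eqx; apply: val_inj => /=; apply/eqP/negPn/negP => neij.
    apply: (ordx (j - i)%N); first by move: leij neij (ltZ j); lia.
    by apply: (mulIg (x ^+ i)); rewrite -expgnDr subnK // mul1g.
  move=> i j eqx; case: (leqP i j) => [|/ltnW] le_; first exact: inj.
  by apply/esym/inj.
- apply/seteqP; split=> y.
    move=> [i _ <-]; apply/(gen_subgroup1P (ltnW n1) xn).
    by exists (i : nat).
  move=> /(gen_subgroup1P (ltnW n1) xn)[k kn ->].
  have kn' : (k < (Zp_trunc n).+2)%N by rewrite Zp_cast.
  by exists (Ordinal kn').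
Qed.

End Subgroups.

(** * Reduced words *)

Section ReducedWords.
Variables (gT : groupType) (d : nat) (H : 'I_d -> set gT).
Hypothesis sH : forall j, subgroup (H j).
Implicit Types (w : seq gT) (x y g : gT) (j : 'I_d).

Lemma reduced_nil : reduced H [::].
Proof. by split. Qed.

(** Adjacent letters of the empty tail must not be compared: its default head
    is 1, which lies in every factor. *)
Lemma reduced_cons x w : reduced H (x :: w) <->
  [/\ exists j, H j x, x <> 1, reduced H w &
      w <> [::] -> forall j, H j x -> ~ H j (head 1 w)].
Proof.
split.
  case=> Hw w1 wadj; split.
  - by apply: Hw; rewrite mem_head.
  - by apply: w1; rewrite mem_head.
  - split.
    + by move=> y yw; apply: Hw; rewrite in_cons yw orbT.
    + by move=> y yw; apply: w1; rewrite in_cons yw orbT.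
    + by move=> i ilt; apply: (wadj i.+1).
  - move=> wN j Hx Hy; apply: (wadj 0%N); first by case: (w) wN.
    by exists j; rewrite /= nth0.
case=> Hx x1 [Hw w1 wadj] adj0; split.
- by move=> y; rewrite in_cons => /predU1P[->//|/Hw].
- by move=> y; rewrite in_cons => /predU1P[->//|/w1].
- case=> [|i] /= ilt; last exact: wadj.
  rewrite nth0 => -[j [Hjx Hjw]].
  by apply: (adj0 _ j) => //; case: (w) ilt.
Qed.

Hypothesis HI : forall i j x, H i x -> H j x -> x <> 1 -> i = j.

(** A reduced word is multiplied by an element of a factor by merging the
    element into the first letter when both lie in that factor, and by
    prepending it otherwise. *)
Lemma reduced_mul j h w : H j h -> reduced H w ->
  exists2 w', reduced H w' & \prod_(x <- w') x = h * \prod_(x <- w) x.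
Proof.
move=> Hh; have [-> rw|h1] := pselect (h = 1).
  by exists w; rewrite ?mul1g.
case: w => [|x w] rw.
  exists [:: h]; last by rewrite !big_cons.
  by apply/reduced_cons; split=> //; exists j.
have [Hx|nHx] := pselect (H j x); last first.
  exists [:: h, x & w]; last by rewrite !big_cons.
  apply/reduced_cons; split=> //; first by exists j.
  by move=> _ i Hih; rewrite -(HI Hh Hih h1).
have /reduced_cons[_ x1 rw' adj] := rw.
have [hx1|hx1] := pselect (h * x = 1).
  by exists w; rewrite // big_cons mulgA hx1 mul1g.
have Hhx : H j (h * x) by apply: subgroupM.
exists (h * x :: w); last by rewrite !big_cons mulgA.
apply/reduced_cons; split=> //; first by exists j.
by move=> wN i Hi; rewrite -(HI Hhx Hi hx1); apply: adj.
Qed.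

Lemma reduced_expression g : gen_subgroup (\bigcup_j H j) g ->
  exists2 w, reduced H w & \prod_(x <- w) x = g.
Proof.
pose S := [set g | exists2 w, reduced H w & \prod_(x <- w) x = g].
(* Closure under inversion is only visible for the elements that stabilize S
   by left multiplication together with their inverses. *)
pose L := [set g | (forall s, S s -> S (g * s)) /\
                   (forall s, S s -> S (g^-1 * s))].
have sL : subgroup L.
  apply/subgroupP; split; first by split=> s; rewrite ?invg1 mul1g.
  move=> x y [Lx LVx] [Ly LVy]; split=> s Ss.
    by rewrite -mulgA; apply: Lx; apply: LVy.
  by rewrite invgF -mulgA; apply: Ly; apply: LVx.
have HL : \bigcup_j H j `<=` L.
  move=> h [j _ Hh]; split=> _ [w rw <-].
    by have [w' rw' e] := reduced_mul Hh rw; exists w'.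
  have [w' rw' e] := reduced_mul (subgroupV (sH j) Hh) rw.
  by exists w'.
move=> Gg; have [+ _] : L g by apply: Gg.
move=> /(_ 1); rewrite mulg1; apply.
by exists [::]; [exact: reduced_nil | rewrite big_nil].
Qed.

End ReducedWords.

(** * The ping-pong lemma *)

Section PingPong.
Variables (gT : groupType) (P : Type) (act : gT -> P -> P).
Hypothesis act1 : forall p, act 1 p = p.
Hypothesis actM : forall x y p, act (x * y) p = act x (act y p).
Variables (d : nat) (H : 'I_d -> set gT) (X : 'I_d -> set P) (v : P).
Hypothesis sH : forall j, subgroup (H j).
Hypothesis Xdisj : forall i j p, X i p -> X j p -> i = j.
Hypothesis vX : forall j, ~ X j v.
Hypothesis vplay : forall j h, H j h -> h <> 1 -> X j (act h v).
Hypothesis Xplay : forall i j h p, i <> j ->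
  H j h -> h <> 1 -> X i p -> X j (act h p).

Lemma pingpong_trivI i j x : H i x -> H j x -> x <> 1 -> i = j.
Proof. by move=> Hi Hj x1; apply: (Xdisj (p := act x v)); apply: vplay. Qed.

Let wact (w : seq gT) := act (\prod_(x <- w) x) v.

(** The first letter decides the piece in which a reduced word puts the base
    point, by induction on the word. *)
Lemma reduced_act_head j x w :
  H j x -> reduced H (x :: w) -> X j (wact (x :: w)).
Proof.
rewrite /wact; elim: w j x => [|y w IHw] j x Hx /reduced_cons[_ x1 rw adj].
  by rewrite big_cons big_nil mulg1; apply: vplay.
rewrite big_cons actM; have /reduced_cons[[i Hy] _ _ _] := rw.
apply: (@Xplay i) => //; last exact: IHw.
by move=> eij; move: Hy; rewrite eij; apply: adj.
Qed.

(** The tail of a reduced word that begins in the factor j leaves the base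
    point outside the piece of j, in the form that the ping-pong hypotheses can
    use: it fixes v, or it brings v into another piece. *)
Lemma reduced_act_tail j x w : H j x -> reduced H (x :: w) ->
  wact w = v \/ exists2 i, i <> j & X i (wact w).
Proof.
case: w => [|y w] Hx /reduced_cons[_ x1 rw adj].
  by left; rewrite /wact big_nil.
right; have /reduced_cons[[i Hy] _ _ _] := rw.
exists i; last exact: reduced_act_head.
by move=> eij; move: Hy; rewrite eij; apply: adj.
Qed.

(** Two reduced words with equal products begin in the same factor, since they
    move the base point to the same piece.  If their first letters x and y
    differed, then the nontrivial element y^-1 x of this factor would bring the
    point of one tail into the piece of the factor, while the point of the
    other tail lies outside it. *)
Lemma pingpong_unique w w' : reduced H w -> reduced H w' ->
  \prod_(x <- w) x = \prod_(x <- w') x -> w = w'.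
Proof.
elim: w w' => [|x w IHw] [|y w'] // rw rw' eww'.
- have /reduced_cons[[j Hy] _ _ _] := rw'.
  have := reduced_act_head Hy rw'.
  by rewrite /wact -eww' big_nil act1 => /vX.
- have /reduced_cons[[j Hx] _ _ _] := rw.
  have := reduced_act_head Hx rw.
  by rewrite /wact eww' big_nil act1 => /vX.
have /reduced_cons[[j Hx] _ redw _] := rw.
have /reduced_cons[[k Hy] _ redw' _] := rw'.
have ejk : k = j.
  have := reduced_act_head Hx rw; rewrite /wact eww'.
  by apply: Xdisj; apply: reduced_act_head.
rewrite {k}ejk in Hy.
have [exy|nxy] := pselect (x = y).
  rewrite exy; congr (_ :: _); apply: IHw => //.
  by apply: (mulgI x); move: eww'; rewrite !big_cons exy.
have Hz : H j (y^-1 * x) by apply: subgroupM => //; apply: subgroupV.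
have z1 : y^-1 * x <> 1.
  by move=> z1; apply: nxy; rewrite -[x](mulKVg y) z1 mulg1.
have Xz : X j (act (y^-1 * x) (wact w)).
  case: (reduced_act_tail Hx rw) => [->|[i nij Xi]]; first exact: vplay.
  exact: Xplay Xi.
have ez : act (y^-1 * x) (wact w) = wact w'.
  rewrite /wact -actM -mulgA; congr (act _ v).
  by move: eww'; rewrite !big_cons => ->; rewrite mulKg.
rewrite ez in Xz.
case: (reduced_act_tail Hy rw') => [ev|[i nij Xi]].
  by rewrite ev in Xz; case: (vX Xz).
by case: nij; apply: Xdisj Xi Xz.
Qed.

Lemma pingpong_free_product :
  free_product (gen_subgroup (\bigcup_j H j)) H.
Proof.
split; first exact: gen_subgroup_subgroup.
  by move=> j; split=> // h Hh L [_]; apply; exists j.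
move=> g /(reduced_expression sH pingpong_trivI)[w rw ew].
exists w; split=> // w' [rw' ew'].
by apply: pingpong_unique; rewrite ?ew.
Qed.

End PingPong.

(** * The pieces in three-space *)

Section Cones.
Local Open Scope ring_scope.
Import Order.TTheory GRing.Theory Num.Theory.
Variable K : realType.
Implicit Types p : 'cV[K]_3.

(** Up to the factors -4, -2, -4, the coordinates of p in a basis whose outer
    vectors span the lines fixed by the parabolic elements R T and R^-1 T, and
    whose middle vector is fixed by T. *)
Definition alpha p : K := p 0 0 + p 1 0 + p 2%:R 0.
Definition beta p : K := 3 * p 0 0 + p 1 0 - p 2%:R 0.
Definition gamma p : K := 3 * p 0 0 - p 1 0 - p 2%:R 0.

Lemma mulmx3E (A : 'M[K]_3) p i :
  (A *m p) i 0 = A i 0 * p 0 0 + A i 1 * p 1 0 + A i 2%:R * p 2%:R 0.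
Proof.
rewrite mxE !big_ord_recl big_ord0 addr0 addrA.
rewrite (_ : lift ord0 ord0 = 1); last exact: val_inj.
by rewrite (_ : lift ord0 (lift ord0 ord0) = 2%:R) //; apply: val_inj.
Qed.

Definition GLact (g : GL 3 K) p : 'cV[K]_3 := g *m p.

Lemma GLact1 p : GLact 1%g p = p.
Proof. exact: mul1mx. Qed.

Lemma GLactM g h p : GLact (g * h)%g p = GLact g (GLact h p).
Proof. by rewrite /GLact mulmxA. Qed.

Lemma coords_R p :
  [/\ alpha (GLact (Rgl K) p) = - (2 * alpha p - 2 * beta p + gamma p),
      beta (GLact (Rgl K) p) = - (2 * alpha p - beta p)
    & gamma (GLact (Rgl K) p) = - alpha p].
Proof. by split; rewrite /alpha /beta /gamma !mulmx3E !mxE /=; ring. Qed.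

Lemma coords_T p :
  [/\ alpha (GLact (Tgl K) p) = - gamma p,
      beta (GLact (Tgl K) p) = beta p
    & gamma (GLact (Tgl K) p) = - alpha p].
Proof. by split; rewrite /alpha /beta /gamma !mulmx3E !mxE /=; ring. Qed.

(** The vector with coordinates (4, 2, 4); its images under R, R^2, R^3 are,
    up to sign, (8, 6, 4), (8, 10, 8) and (4, 6, 8), which are in the cone. *)
Definition basepoint : 'cV[K]_3 := \col_i nth 0 [:: 2; -1; 3] i.

Lemma coords_basepoint :
  [/\ alpha basepoint = 4, beta basepoint = 2 & gamma basepoint = 4].
Proof. by split; rewrite /alpha /beta /gamma !mxE /=; ring. Qed.

Definition cone : set 'cV[K]_3 :=
  [set p | [/\ 0 < alpha p, 0 < beta p & 0 < gamma p] \/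
           [/\ alpha p < 0, beta p < 0 & gamma p < 0]].

Definition pieceR : set 'cV[K]_3 := cone `\ basepoint.

(** The image of the cone under T. *)
Definition pieceT : set 'cV[K]_3 :=
  [set p | [/\ 0 < alpha p, beta p < 0 & 0 < gamma p] \/
           [/\ alpha p < 0, 0 < beta p & gamma p < 0]].

Lemma coneN_pieceT p : cone p -> ~ pieceT p.
Proof. by move=> [] [a b c] [] [a' b' c']; lra. Qed.

Lemma basepoint_cone : cone basepoint.
Proof.
by have [a b c] := coords_basepoint; left; split; rewrite ?a ?b ?c.
Qed.

Lemma T_play p : cone p -> pieceT (GLact (Tgl K) p).
Proof.
rewrite /pieceT /=; have [-> -> ->] := coords_T p.
by case=> -[a b c]; [right|left]; split; lra.
Qed.

Lemma cone_pieceR p : cone p ->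
  (alpha p = 4 -> beta p = 2 -> gamma p <> 4) -> pieceR p.
Proof.
by move=> Cp nv; split=> // ep; case: coords_basepoint; rewrite -ep.
Qed.

(** If p is in the piece of T, the coordinates of R^k p are combinations of
    those of p in which all terms have one sign.  The base point is treated at
    the same time because its orbit is computed by the same formulas. *)
Lemma R_play k p : (0 < k < 4)%N -> pieceT p \/ p = basepoint ->
  pieceR (GLact (Rgl K ^+ k)%g p).
Proof.
move=> k4 pTv.
have {pTv}signs : [\/ [/\ 0 < alpha p, beta p < 0 & 0 < gamma p],
    [/\ alpha p < 0, 0 < beta p & gamma p < 0] |
    [/\ alpha p = 4, beta p = 2 & gamma p = 4]].
  case: pTv => [[|]|->];
    by [apply: Or31|apply: Or32|apply/Or33/coords_basepoint].
(* Three applications of the coordinate formula cover all exponents; the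
   equations of the later ones rewrite only when k is large enough. *)
have [a1 b1 c1] := coords_R p.
have [a2 b2 c2] := coords_R (GLact (Rgl K) p).
have [a3 b3 c3] := coords_R (GLact (Rgl K) (GLact (Rgl K) p)).
case: k k4 => [|[|[|[|k]]]] // _; rewrite !expgS expg0 !GLactM GLact1;
  apply: cone_pieceR;
  rewrite /cone /= ?(a3, b3, c3) ?(a2, b2, c2) ?(a1, b1, c1).
all: case: signs => -[a b c].
all: by first [left; split; lra | right; split; lra | move=> ? ? ?; lra].
Qed.

Lemma Rgl_expg4 : (Rgl K ^+ 4 = 1)%g.
Proof.
apply: val_inj; rewrite /= !mulmxA.
have R2 : Rmx K *m Rmx K = mx3 [:: [:: 0; -1; 1]; [:: 0; -1; 0]; [:: 1; -1; 0]].
  apply/matrixP => -[[|[|[|i]]] Hi] // -[[|[|[|j]]] Hj] //;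
    rewrite !mxE !big_ord_recl big_ord0 !mxE /=; ring.
rewrite R2 -mulmxA R2.
apply/matrixP => -[[|[|[|i]]] Hi] // -[[|[|[|j]]] Hj] //;
  rewrite !mxE !big_ord_recl big_ord0 !mxE /=; ring.
Qed.

Lemma Tgl_expg2 : (Tgl K ^+ 2 = 1)%g.
Proof.
apply: val_inj; rewrite /=.
apply/matrixP => -[[|[|[|i]]] Hi] // -[[|[|[|j]]] Hj] //;
  rewrite !mxE !big_ord_recl big_ord0 !mxE /=; ring.
Qed.

(** A power of R equal to 1 would fix the base point, which R_play puts in a
    piece that omits it. *)
Lemma Rgl_expg_neq1 k : (0 < k < 4)%N -> (Rgl K ^+ k <> 1)%g.
Proof.
move=> k4 Rk; have [_] := R_play k4 (or_intror (erefl basepoint)).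
by rewrite Rk GLact1 => nv; apply: nv.
Qed.

Lemma Tgl_neq1 : (Tgl K <> 1)%g.
Proof.
move=> T1; have := T_play basepoint_cone; rewrite T1 GLact1.
exact: coneN_pieceT basepoint_cone.
Qed.

End Cones.

Theorem theorem2p3 (K : realType) :
  let R : GL 3 K := Rgl K in
  let T : GL 3 K := Tgl K in
  [/\ R ^+ 4 = 1,
      T ^+ 2 = 1,
      free_product (gen_subgroup [set R; T])
        (tnth [tuple gen_subgroup [set R]; gen_subgroup [set T]]),
      isomorphic_to (gen_subgroup [set R]) 'Z_4
    & isomorphic_to (gen_subgroup [set T]) 'Z_2].
Proof.
move=> R T; have R4 := Rgl_expg4 K; have T2 := Tgl_expg2 K.
split=> //; last 2 first.
- by apply: gen_subgroup1_isomorphic_Zp => //; apply: Rgl_expg_neq1.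
- apply: gen_subgroup1_isomorphic_Zp => // -[|[|k]] // _.
  by rewrite expg1; apply: Tgl_neq1.
set H := tnth _.
have H0 : H ord0 = gen_subgroup [set R] by [].
have H1 : H ord_max = gen_subgroup [set T] by [].
have HP (j : 'I_2) : j = ord0 \/ j = ord_max.
  by case: j => [[|[|j]] ltj] //; [left|right]; apply: val_inj.
have -> : gen_subgroup [set R; T] = gen_subgroup (\bigcup_j H j).
  apply/seteqP; split; apply: gen_subgroup_mono => x.
    by case=> ->; apply: sub_gen_smallest;
      [exists ord0 => //; rewrite H0 | exists ord_max => //; rewrite H1];
      apply: sub_gen_smallest.
  by move=> [j _]; case: (HP j) => ->; rewrite ?H0 ?H1;
    apply: gen_subgroup_mono => _ ->; apply: sub_gen_smallest; [left|right].
pose X := tnth [tuple @pieceR K; @pieceT K].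
have HRP h : gen_subgroup [set R] h -> h <> 1 ->
    exists2 k, (0 < k < 4)%N & h = R ^+ k.
  move=> /(gen_subgroup1P (isT : 0 < 4)%N R4)[[|k] k4 ->] h1.
    by case: h1.
  by exists k.+1.
have HTP h : gen_subgroup [set T] h -> h <> 1 -> h = T.
  by move=> /(gen_subgroup1P (isT : 0 < 2)%N T2)[[|[|k]] k2 ->].
have X0 : X ord0 = @pieceR K by [].
have X1 : X ord_max = @pieceT K by [].
apply: (@pingpong_free_product _ _ (@GLact K) _ _ _ _ X (basepoint K)).
- exact: GLact1.
- exact: GLactM.
- by move=> j; case: (HP j) => ->; apply: gen_subgroup_subgroup.
- move=> i j p; case: (HP i) => ->; case: (HP j) => -> //; rewrite X0 X1.
    by move=> [Cp _] /(coneN_pieceT Cp).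
  by move=> + [Cp _] => /(coneN_pieceT Cp).
- move=> j; case: (HP j) => ->; first by move=> [_]; apply.
  exact/coneN_pieceT/basepoint_cone.
- move=> j h; case: (HP j) => ->; rewrite ?H0 ?H1 ?X0 ?X1 => Hh h1.
    by have [k k4 ->] := HRP h Hh h1; apply: R_play => //; right.
  by rewrite (HTP h Hh h1); apply/T_play/basepoint_cone.
- move=> i j h p; case: (HP i) => ->; case: (HP j) => -> // _;
    rewrite ?H0 ?H1 X0 X1 => Hh h1 Xp.
    by rewrite (HTP h Hh h1); apply: T_play; case: Xp.
  by have [k k4 ->] := HRP h Hh h1; apply: R_play => //; left.
Qed.
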